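(* Let $n, m \geq 1$ be integers and let $X$ be an $n$-dimensional real normed space with $d_{BM}(X, \ell_1^n) \leq 3$. Then \[ d_{BM}(X \oplus_1 \ell^m_1, \ell^{n+m}_1) = d_{BM}(X, \ell_1^n). \] Similarly, if $X$ is an $n$-dimensional real normed space with $d_{BM}(X, \ell_{\infty}^n) \leq 3$, then \[ d_{BM}(X \oplus_{\infty} \ell^m_{\infty}, \ell^{n+m}_{\infty}) = d_{BM}(X, \ell_{\infty}^n). \]
   Context: $\ell_1^n$ and $\ell_\infty^n$ denote $\mathbb{R}^n$ with the norms $\|x\|_1 = \sum_i |x_i|$ and $\|x\|_\infty = \max_i |x_i|$. For normed spaces $X, Y$, the sum $X \oplus_1 Y$ is $X \times Y$ with norm $\|(x,y)\| = \|x\|_X + \|y\|_Y$, and $X \oplus_\infty Y$ is $X \times Y$ with norm $\|(x,y)\| = \max\{\|x\|_X, \|y\|_Y\}$. The Banach--Mazur distance between two real normed spaces $X, Y$ of the same finite dimension is $d_{BM}(X,Y) = \inf \|T\|\,\|T^{-1}\|$, the infimum over all invertible linear operators $T: X \to Y$, with operator norms. *)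

(* Defs.v *)
From HB Require Import structures.
From mathcomp Require Import all_boot all_order all_algebra.
From mathcomp Require Import all_classical all_reals.
From mathcomp Require Import topology normedtype.

Set Implicit Arguments.
Unset Strict Implicit.
Unset Printing Implicit Defensive.

Import Order.TTheory GRing.Theory Num.Theory.
Import numFieldNormedType.Exports.

Local Open Scope classical_set_scope.
Local Open Scope ring_scope.

(* Aliases are needed because 'rV[R]_n and X * Y already carry the max norm. *)
Definition ell1 (R : realType) (n : nat) : Type := 'rV[R]_n.

Section Ell1.
Variables (R : realType) (n : nat).

HB.instance Definition _ := GRing.Lmodule.copy (ell1 R n) 'rV[R]_n.

Definition ell1_norm (x : ell1 R n) : R := \sum_(i < n) `|(x : 'rV[R]_n) ord0 i|.

Lemma ell1_normD (x y : ell1 R n) :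
  ell1_norm (x + y) <= ell1_norm x + ell1_norm y.
Proof.
rewrite /ell1_norm -big_split /=; apply: ler_sum => i _.
by rewrite mxE ler_normD.
Qed.

Lemma ell1_normZ (a : R) (x : ell1 R n) :
  ell1_norm (a *: x) = `|a| * ell1_norm x.
Proof.
rewrite /ell1_norm mulr_sumr; apply: eq_bigr => i _.
by rewrite mxE normrM.
Qed.

Lemma ell1_norm_eq0 (x : ell1 R n) : ell1_norm x = 0 -> x = 0.
Proof.
move=> /eqP; rewrite psumr_eq0 // => /allP x0.
apply/rowP => i; rewrite mxE; apply/eqP; rewrite -normr_eq0.
exact: (x0 i (mem_index_enum i)).
Qed.

HB.instance Definition _ :=
  Lmodule_isNormed.Build R (ell1 R n) ell1_normD ell1_normZ ell1_norm_eq0.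

Lemma ell1_normE (x : ell1 R n) :
  `|x| = \sum_(i < n) `|(x : 'rV[R]_n) ord0 i|.
Proof. by []. Qed.

End Ell1.

Definition sum1 (R : realType) (X Y : normedModType R) : Type := (X * Y)%type.

Section Sum1.
Variables (R : realType) (X Y : normedModType R).

HB.instance Definition _ := GRing.Lmodule.copy (sum1 X Y) (X * Y)%type.

Definition sum1_norm (p : sum1 X Y) : R := `|p.1| + `|p.2|.

Lemma sum1_normD (p q : sum1 X Y) :
  sum1_norm (p + q) <= sum1_norm p + sum1_norm q.
Proof. by rewrite /sum1_norm addrACA lerD // ler_normD. Qed.

Lemma sum1_normZ (a : R) (p : sum1 X Y) :
  sum1_norm (a *: p) = `|a| * sum1_norm p.
Proof. by rewrite /sum1_norm !normrZ mulrDr. Qed.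

Lemma sum1_norm_eq0 (p : sum1 X Y) : sum1_norm p = 0 -> p = 0.
Proof.
case: p => x y /eqP; rewrite /sum1_norm /= paddr_eq0 // !normr_eq0.
by case/andP => /eqP -> /eqP ->.
Qed.

HB.instance Definition _ :=
  Lmodule_isNormed.Build R (sum1 X Y) sum1_normD sum1_normZ sum1_norm_eq0.

Lemma sum1_normE (p : sum1 X Y) : `|p| = `|p.1| + `|p.2|.
Proof. by []. Qed.

End Sum1.

Notation ellinf R n := ('rV[R]_n) (only parsing).
Notation suminf X Y := ((X * Y)%type) (only parsing).

Lemma ellinf_normE (R : realType) (n : nat) (x : ellinf R n) :
  `|x| = \big[Num.max/0]_(i < n) `|x ord0 i|.
Proof.
rewrite [LHS]mx_normrE.
apply/le_anti/andP; split.
  apply/bigmax_leP; split=> [|[i j] _ /=]; first by apply/bigmax_geP; left.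
  by rewrite (ord1 i); apply/bigmax_geP; right; exists j.
apply/bigmax_leP; split=> [|j _]; first by apply/bigmax_geP; left.
by apply/bigmax_geP; right; exists (ord0, j).
Qed.

Lemma suminf_normE (R : realType) (X Y : normedModType R) (p : suminf X Y) :
  `|p| = Num.max `|p.1| `|p.2|.
Proof. exact: prod_normE. Qed.

(* [sup] is meaningful for bounded operators only, and [inf] below for a
   nonempty set only; both hold between spaces of the same finite dimension. *)
Definition opnorm (R : realType) (X Y : normedModType R) (T : X -> Y) : R :=
  sup [set `|T x| | x in [set x : X | `|x| <= 1]].

Definition bm_dist (R : realType) (X Y : normedModType R) : R :=
  inf [set d : R | exists (T : {linear X -> Y}) (S : {linear Y -> X}),
         [/\ cancel T S, cancel S T & d = opnorm T * opnorm S]].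
Arguments bm_dist {R} X Y.

(* Main.v *)
(* One inequality extends a map X -> ell^n by the identity.  For the other, a map
   with |x| <= |f x| <= d|x|, d <= 3, loses one extra coordinate at a time; we
   describe the max-norm case f : X (+) R -> R^(N+1), the other being its dual.
   Write f (x, r) = phi x + r s, and let v be the R-coordinate of f^-1, so that
   v . s = 1 and sum |v_i| <= 1.  Hence some j has |s_j| >= 1 and s_j v_j >= 0.
   With c = sg (s_j) / (1 + |s_j|), the map g x = (phi_i x - c s_i phi_j x)_(i <> j)
   works.  As |phi_i x| <= (d - |s_i|)|x| and |c|(d - |s_j|) <= 1 when d <= 3, its
   norm is at most d.  For the lower bound take r = - c phi_j x: the entries of
   f (x, r) other than the j-th are those of g x, the j-th one is |c| phi_j x, and
   r = v . f (x, r) forces it to be at most |g x|, so |x| <= |f (x, r)| <= |g x|. *)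
From HB Require Import structures.
Require Import Defs.
From mathcomp Require Import all_boot all_order all_algebra.
From mathcomp Require Import all_classical all_reals.
From mathcomp Require Import topology normedtype derive.
From mathcomp Require Import ring lra.

Set Implicit Arguments.
Unset Strict Implicit.
Unset Printing Implicit Defensive.

Import Order.TTheory GRing.Theory Num.Theory.
Import numFieldNormedType.Exports.

Local Open Scope ring_scope.

(** The proof argument lets the canonical linear structure attach to a bare function; [linear_of lf]
    is convertible to [f]. *)
Definition linear_of (R : pzRingType) (U V : lmodType R) (f : U -> V)
  of linear f : U -> V := f.

HB.instance Definition _ (R : pzRingType) (U V : lmodType R) (f : U -> V)
    (lf : linear f) :=
  GRing.isLinear.Build R U V *:%R (linear_of lf) lf.

(** * Linear maps in finite dimension *)

Lemma rV_basisE (R : pzRingType) (Y : lmodType R) n (h : {linear 'rV[R]_n -> Y})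
    (a : 'rV[R]_n) :
  h a = \sum_i a ord0 i *: h (delta_mx 0 i).
Proof.
by rewrite {1}(row_sum_delta a) linear_sum; apply: eq_bigr => i _; rewrite linearZ.
Qed.

Lemma ler_norm_rV (R : realType) n (a : 'rV[R]_n) i : `|a ord0 i| <= `|a|.
Proof.
by rewrite ellinf_normE; exact: (@le_bigmax _ _ _ _ (fun i => `|a ord0 i|)).
Qed.

Lemma rV_norm_leP (R : realType) n (a : 'rV[R]_n) (M : R) :
  0 <= M -> (forall i, `|a ord0 i| <= M) -> `|a| <= M.
Proof. by move=> M0 aM; rewrite ellinf_normE; apply/bigmax_leP; split. Qed.

Lemma bounded_rV (R : realType) n (Y : normedModType R)
    (h : {linear 'rV[R]_n -> Y}) :
  exists C : R, forall a, `|h a| <= C * `|a|.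
Proof.
exists (\sum_i `|h (delta_mx 0 i)|) => a.
rewrite rV_basisE (le_trans (ler_norm_sum _ _ _)) // mulr_suml ler_sum // => i _.
by rewrite normrZ mulrC ler_wpM2l // ler_norm_rV.
Qed.

(* The continuous function [a |-> `|g a|] attains a positive minimum on the
   compact unit sphere. *)
Lemma bounded_below_rV (R : realType) n (X : normedModType R)
    (g : {linear 'rV[R]_n -> X}) :
  injective g -> exists C : R, forall a, `|a| <= C * `|g a|.
Proof.
move=> ginj.
pose A := [set a : 'rV[R]_n | `|a| = 1]%classic.
have [A0|/set0P/negP] := pselect (A !=set0)%classic; last first.
  (* An empty unit sphere leaves only the zero vector, so the constant 0 works. *)
  rewrite negbK => /eqP A0; exists 0 => a; rewrite mul0r.
  have [->|a0] := eqVneq a 0; first by rewrite normr0.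
  suff: A (`|a|^-1 *: a) by rewrite A0.
  by rewrite /A /= normrZ normfV normr_id mulVf // normr_eq0.
have cg : continuous (fun a => `|g a|).
  have [C gC] := bounded_rV g.
  have cg' : continuous g.
    apply: bounded_linear_continuous; apply/linear_boundedP.
    by near=> K => a; apply: (le_trans (gC a)); rewrite ler_wpM2r //;
      near: K; apply: nbhs_pinfty_ge; rewrite num_real.
  by move=> a; apply: continuous_comp; [exact: cg'|exact: norm_continuous].
have [] := @EVT_min_rV R n (fun a => `|g a|) A A0.
- apply: bounded_closed_compact.
  + by exists 1; split => // M M1 a; rewrite /A /= => ->; exact: ltW.
  + apply: (@closed_comp _ _ (fun a : 'rV[R]_n => `|a|) [set 1]%classic).
      by move=> a _; exact: norm_continuous.
    exact: closed_eq.
- exact: continuous_subspaceT.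
move=> c; rewrite inE /A /= => c1 cmin.
have gc0 : 0 < `|g c|.
  rewrite normr_gt0; apply/eqP => gc; move: c1.
  have -> : c = 0 by apply: ginj; rewrite gc linear0.
  by rewrite normr0 => /esym/eqP; rewrite oner_eq0.
exists (`|g c|^-1) => a; rewrite mulrC ler_pdivlMr //.
have [->|a0] := eqVneq a 0; first by rewrite normr0 mul0r.
have na0 : 0 < `|a| by rewrite normr_gt0.
have := cmin (`|a|^-1 *: a).
rewrite inE /A /= linearZ /= !normrZ normfV normr_id mulVf ?gt_eqF // => /(_ erefl).
by rewrite mulrC ler_pdivlMr // mulrC.
Unshelve. all: by end_near. Qed.

Lemma linear_can_sym (R : pzRingType) (U V : lmodType R) (f : {linear U -> V}) g :
  cancel g f -> cancel f g -> linear g.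
Proof.
by move=> gK fK a u v; rewrite -{1}(gK u) -{1}(gK v) -linearP fK.
Qed.

Lemma linear_inverse (R : pzRingType) (U V : lmodType R) (f : {linear U -> V}) :
  bijective f -> exists g : {linear V -> U}, cancel f g /\ cancel g f.
Proof.
by case=> g fK gK; exists (linear_of (linear_can_sym gK fK)); split.
Qed.

(** Factor [T] through coordinates: [T \o G] is bounded on row vectors, and the coordinate map [f]
    is bounded because its inverse [G] is bounded below. *)
Lemma bounded_findim (R : realType) n (X Y : normedModType R)
    (T : {linear X -> Y}) :
  Vector.axiom n X -> exists C : R, forall x, `|T x| <= C * `|x|.
Proof.
case=> f lf [g fK gK].
pose F := linear_of lf.
have lg : linear g by exact: (@linear_can_sym _ _ _ F).
pose G : {linear 'rV[R]_n -> X} := linear_of lg.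
have [C1 C1P] := bounded_rV (T \o G).
have [|C2 C2P] := @bounded_below_rV R n X G; first exact: can_inj gK.
exists (`|C1| * C2) => x.
rewrite -{1}(fK x); apply: (le_trans (C1P (f x))).
rewrite -mulrA; apply: (@le_trans _ _ (`|C1| * `|f x|)).
  by rewrite ler_wpM2r // ler_norm.
rewrite ler_wpM2l //; apply: (le_trans (C2P _)).
by have -> : G (f x) = x by exact: fK.
Qed.

(** In coordinates [T] is a square matrix with trivial kernel, hence invertible. *)
Lemma inj_lin_bij (R : realType) n (X Y : lmodType R) (T : {linear X -> Y}) :
  Vector.axiom n X -> Vector.axiom n Y -> injective T -> bijective T.
Proof.
move=> [f lf [f' fK f'K]] [g lg [g' gK g'K]] Tinj.
have lf' : linear f' by exact: (@linear_can_sym _ _ _ (linear_of lf)).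
pose F' : {linear 'rV[R]_n -> X} := linear_of lf'.
pose G : {linear Y -> 'rV[R]_n} := linear_of lg.
pose M := lin1_mx (G \o T \o F').
have Minj : row_free M.
  apply/inj_row_free => v.
  rewrite mul_rV_lin1 /= => h.
  apply: (can_inj f'K); apply: Tinj; apply: (can_inj gK).
  transitivity (G (T (F' v))) => //; rewrite [LHS]h.
  by transitivity (G (T (F' 0))) => //; rewrite !linear0.
have Mu : M \in unitmx by rewrite -row_free_unit.
have TE x : g (T x) = f x *m M by rewrite mul_rV_lin1 /= /F' /linear_of fK.
exists (fun y => f' (g y *m invmx M)) => [x|y].
  by rewrite TE mulmxK // fK.
by apply: (can_inj gK); rewrite TE f'K mulmxKV.
Qed.

(** * Operator norms and the Banach-Mazur distance *)

Lemma opnorm_ge0 (R : realType) (X Y : normedModType R) (T : {linear X -> Y}) :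
  0 <= opnorm T.
Proof.
rewrite /opnorm; set E := (X in sup X).
(* By convention [sup] is 0 on a set without supremum; otherwise the set contains 0, the value at
   the origin. *)
have [[_ ubE]|/sup_out ->//] := pselect (has_sup E).
by apply: ub_le_sup => //; exists 0; rewrite /= ?linear0 normr0 ?ler01.
Qed.

Lemma opnorm_le (R : realType) (X Y : normedModType R) (T : {linear X -> Y}) (C : R) :
  0 <= C -> (forall x, `|T x| <= C * `|x|) -> opnorm T <= C.
Proof.
move=> C0 TC; apply: ge_sup.
  by exists 0, 0; rewrite /= ?linear0 normr0 ?ler01.
by move=> _ [x /= x1 <-]; rewrite (le_trans (TC x)) // ler_piMr.
Qed.

(** A bound [C] makes the defining set bounded, so its supremum dominates the value at the
    normalised vector. *)
Lemma ler_opnorm (R : realType) (X Y : normedModType R) (T : {linear X -> Y}) (C : R) :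
  (forall x, `|T x| <= C * `|x|) -> forall x, `|T x| <= opnorm T * `|x|.
Proof.
move=> TC x.
have [->|x0] := eqVneq x 0; first by rewrite linear0 !normr0 mulr0.
have nx0 : 0 < `|x| by rewrite normr_gt0.
have uT : has_ubound [set `|T x| | x in [set x : X | `|x| <= 1]]%classic.
  exists `|C| => _ [y /= y1 <-]; rewrite (le_trans (TC y)) //.
  by rewrite (le_trans (ler_wpM2r _ (ler_norm C))) // ler_piMr.
rewrite -ler_pdivrMr // mulrC; apply: (ub_le_sup uT).
exists (`|x|^-1 *: x); first by rewrite /= normrZ normfV normr_id mulVf ?gt_eqF.
by rewrite linearZ /= normrZ normfV normr_id.
Qed.

(** A pair T, T^-1 rescaled so that T^-1 has norm at most 1 and T norm at most [d]; the distance is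
    governed by the admissible [d]. *)
Definition bilip (R : realType) (X Y : normedModType R) (d : R) : Prop :=
  exists2 T : {linear X -> Y}, bijective T &
    forall x, `|x| <= `|T x| <= d * `|x|.

Lemma exists_nonzero (R : realType) n (X : normedModType R) :
  (0 < n)%N -> Vector.axiom n X -> exists x : X, x != 0.
Proof.
move=> n0 [f lf [g fK gK]]; exists (g (const_mx 1)); apply/eqP => g0.
have := gK (const_mx 1); rewrite g0.
have -> : f 0 = 0 by rewrite -[f](_ : linear_of lf = f) // linear0.
by move/rowP/(_ (Ordinal n0)); rewrite !mxE => /esym/eqP; rewrite oner_eq0.
Qed.

Lemma bilip_ge1 (R : realType) n (X Y : normedModType R) d :
  (0 < n)%N -> Vector.axiom n X -> bilip X Y d -> 1 <= d.
Proof.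
move=> n0 vX [T _ Td]; have [x x0] := exists_nonzero n0 vX.
rewrite -(@ler_pM2r _ `|x|) ?normr_gt0 // mul1r.
by have /andP[/le_trans] := Td x; apply.
Qed.

(** The inverse scaled by [d] satisfies the same two bounds. *)
Lemma bilip_sym (R : realType) (X Y : normedModType R) d :
  0 < d -> bilip X Y d -> bilip Y X d.
Proof.
move=> d0 [T /linear_inverse [S [TK SK]] Td].
exists (d \*: S) => [|y].
  exists (d^-1 \*: T) => [y|x] /=.
    by rewrite linearZ /= SK scalerA mulVf ?scale1r // gt_eqF.
  by rewrite linearZ /= TK scalerA mulfV ?scale1r // gt_eqF.
have := Td (S y); rewrite SK /= normrZ gtr0_norm // => /andP[h1 ->] /=.
by rewrite ler_pM2l.
Qed.

Lemma bm_dist_le (R : realType) (X Y : normedModType R) d :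
  0 <= d -> bilip X Y d -> bm_dist X Y <= d.
Proof.
move=> d0 [T /linear_inverse [S [TK SK]] Td].
have Tle : opnorm T <= d by apply: opnorm_le => // x; case/andP: (Td x).
have Sle : opnorm S <= 1.
  apply: opnorm_le => // y; rewrite mul1r.
  by have /andP[] := Td (S y); rewrite SK.
apply: (@le_trans _ _ (opnorm T * opnorm S)); last first.
  by rewrite -[leRHS]mulr1 ler_pM // opnorm_ge0.
apply: ge_inf; last by exists T, S; split.
by exists 0 => _ [T' [S' [_ _ ->]]]; rewrite mulr_ge0 // opnorm_ge0.
Qed.

(* Only finite dimension makes [opnorm] an honest operator norm here. *)
Lemma bilip_opnorm (R : realType) n (X Y : normedModType R)
    (T : {linear X -> Y}) (S : {linear Y -> X}) :
  (0 < n)%N -> Vector.axiom n X -> Vector.axiom n Y ->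
  cancel T S -> cancel S T -> bilip X Y (opnorm T * opnorm S).
Proof.
move=> n0 vX vY TK SK.
have [CT CTP] := bounded_findim T vX; have {CTP} TP := ler_opnorm CTP.
have [CS CSP] := bounded_findim S vY; have {CSP} SP := ler_opnorm CSP.
have b0 : 0 < opnorm S.
  have [y y0] := exists_nonzero n0 vY.
  rewrite lt_neqAle opnorm_ge0 andbT eq_sym; apply/eqP => S0.
  have := SP y; rewrite S0 mul0r normr_le0 => /eqP Sy0.
  by move: y0; rewrite -(SK y) Sy0 linear0 eqxx.
(* This scaling turns |x| = |S (T x)| <= [opnorm S] |T x| into the lower bound. *)
exists (opnorm S \*: T) => [|x].
  exists ((opnorm S)^-1 \*: S) => [x|y] /=.
    by rewrite linearZ /= TK scalerA mulVf ?scale1r // gt_eqF.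
  by rewrite linearZ /= SK scalerA mulfV ?scale1r // gt_eqF.
rewrite /= normrZ gtr0_norm //; apply/andP; split.
  by rewrite -{1}(TK x).
by rewrite [opnorm T * _]mulrC -mulrA ler_pM2l.
Qed.

(** The bound passes to [inf] only over a nonempty set; composing coordinate maps supplies an
    isomorphism. *)
Lemma le_bm_dist (R : realType) n (X Y : normedModType R) (r : R) :
  (0 < n)%N -> Vector.axiom n X -> Vector.axiom n Y ->
  (forall d, bilip X Y d -> r <= d) -> r <= bm_dist X Y.
Proof.
move=> n0 vX vY rP; apply: lb_le_inf; last first.
  by move=> _ [T [S [TK SK ->]]]; apply: rP; exact: (bilip_opnorm n0 vX vY).
have [f lf [f' fK f'K]] := vX; have [g lg [g' gK g'K]] := vY.
have lf' : linear f' by exact: (@linear_can_sym _ _ _ (linear_of lf)).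
have lg' : linear g' by exact: (@linear_can_sym _ _ _ (linear_of lg)).
pose T : {linear X -> Y} := linear_of lg' \o linear_of lf.
pose S : {linear Y -> X} := linear_of lf' \o linear_of lg.
exists (opnorm T * opnorm S), T, S; split => // u.
  by rewrite /T /S /= /linear_of g'K fK.
by rewrite /T /S /= /linear_of f'K gK.
Qed.

(** An admissible [d] above 3 for [Z], [W] already exceeds [bm_dist X Y], so the transfer back is
    asked only for [d] up to 3. *)
Lemma bm_dist_eq (R : realType) n N (X Y Z W : normedModType R) :
  (0 < n)%N -> (0 < N)%N ->
  Vector.axiom n X -> Vector.axiom n Y -> Vector.axiom N Z -> Vector.axiom N W ->
  (forall d, 1 <= d -> bilip X Y d -> bilip Z W d) ->
  (forall d, 1 <= d <= 3 -> bilip Z W d -> bilip X Y d) ->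
  bm_dist X Y <= 3 -> bm_dist Z W = bm_dist X Y.
Proof.
move=> n0 N0 vX vY vZ vW up down le3; apply/le_anti/andP; split.
  apply: (le_bm_dist n0 vX vY) => d dP; have d1 := bilip_ge1 n0 vX dP.
  by apply: bm_dist_le; [rewrite (le_trans _ d1)|exact: up].
apply: (le_bm_dist N0 vZ vW) => d dP; have d1 := bilip_ge1 N0 vZ dP.
have [d3|/ltW d3] := lerP d 3; last exact: le_trans d3.
apply: bm_dist_le; first by rewrite (le_trans _ d1).
by apply: down => //; rewrite d1.
Qed.

(** The lower bound gives injectivity, and equality of dimensions then gives bijectivity. *)
Lemma bilip_findim (R : realType) n (X Y : normedModType R) (f : X -> Y) d :
  Vector.axiom n X -> Vector.axiom n Y -> linear f ->
  (forall x, `|x| <= `|f x| <= d * `|x|) -> bilip X Y d.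
Proof.
move=> vX vY lf fd; exists (linear_of lf) => //.
apply: (inj_lin_bij vX vY) => x y xy; apply/eqP; rewrite -subr_eq0 -normr_le0.
have /andP[/le_trans -> //] := fd (x - y).
by rewrite -[f _]/(linear_of lf _) linearB xy subrr normr0.
Qed.

(** * Removing one coordinate *)

(* [t] is the vector s above. *)
Lemma exists_pivot (R : realType) N (t v : 'I_N -> R) (d : R) :
  \sum_i v i * t i = 1 -> \sum_i `|v i| <= 1 -> d <= 3 ->
  exists j, exists c, [/\ 1 - c * t j = `|c|, `|c| * (d - `|t j|) <= 1
    & `|c + `|c| * v j| = `|c| * (1 + `|v j|)].
Proof.
move=> vt v1 d3.
(* Otherwise v_i t_i < |v_i| wherever v_i is nonzero, and summing gives 1 < 1. *)
have [j vj0 vtj] : exists2 j, v j != 0 & `|v j| <= v j * t j.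
  apply: contrapT => nj.
  have lt j : v j != 0 -> v j * t j < `|v j|.
    by move=> vj0; rewrite ltNge; apply/negP => le; apply: nj; exists j.
  have le j : v j * t j <= `|v j|.
    by have [->|/lt/ltW//] := eqVneq (v j) 0; rewrite mul0r.
  have [j vj0] : exists j, v j != 0.
    apply: contrapT => n0; move: vt; rewrite big1 => [/esym/eqP|j _].
      by rewrite oner_eq0.
    by have [->|vj0] := eqVneq (v j) 0; [rewrite mul0r|case: n0; exists j].
  have : \sum_i v i * t i < \sum_i `|v i|.
    rewrite (bigD1 j) //= [ltRHS](bigD1 j) //=.
    by rewrite ltr_leD ?lt // ler_sum.
  by rewrite vt ltNge v1.
exists j; have tj1 : 1 <= `|t j|.
  rewrite -(@ler_pM2l _ `|v j|) ?normr_gt0 // mulr1 -normrM.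
  exact: le_trans vtj (ler_norm _).
have vtj0 : 0 <= v j * t j by rewrite (le_trans _ vtj).
have u0 : 0 < 1 + `|t j| by rewrite ltr_pwDl.
(* The constant 3 comes from here: d - |t_j| <= 1 + |t_j| follows from d <= 3 and |t_j| >= 1. *)
have cle : (1 + `|t j|)^-1 * (d - `|t j|) <= 1.
  by rewrite mulrC ler_pdivrMr // mul1r; lra.
(* [c] gets the sign of t_j and modulus 1 / (1 + |t_j|). As v_j does not have the opposite sign, [c]
   and |c| v_j add without cancellation. *)
have [tj0|tj0] := lerP 0 (t j).
- have tjE : `|t j| = t j by rewrite ger0_norm.
  have v0 : 0 <= v j by rewrite -(@pmulr_lge0 _ (t j)) // -tjE (lt_le_trans _ tj1).
  exists (1 + `|t j|)^-1; have c0 : 0 <= (1 + `|t j|)^-1 by rewrite invr_ge0 ltW.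
  rewrite !(ger0_norm c0); split => //.
    by rewrite tjE; field; rewrite -tjE gt_eqF.
  rewrite -{1}[X in `|X + _|]mulr1 -mulrDr normrM (ger0_norm c0) (ger0_norm v0).
  by rewrite ger0_norm // addr_ge0.
- have tjE : `|t j| = - t j by rewrite ltr0_norm.
  have v0 : v j <= 0 by rewrite -(@nmulr_lge0 _ (t j)).
  exists (- (1 + `|t j|)^-1); have c0 : 0 <= (1 + `|t j|)^-1 by rewrite invr_ge0 ltW.
  rewrite normrN !(ger0_norm c0); split => //.
    by rewrite tjE; field; rewrite -tjE gt_eqF.
  rewrite -[X in `|X + _|]mulrN1 -mulrDr normrM (ger0_norm c0) (ler0_norm v0).
  by congr (_ * _); rewrite ler0_norm; lra.
Qed.

(** |a| + |b| is the larger of |a + b| and |a - b|. *)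
Lemma ler_add_norm (R : realDomainType) (a b M : R) :
  `|a + b| <= M -> `|a - b| <= M -> `|a| + `|b| <= M.
Proof.
rewrite !ler_norml => /andP[h1 h2] /andP[h3 h4].
by case: (ger0P a) => a0; case: (ger0P b) => b0; lra.
Qed.

(** [Z] plays the max-sum of [W] and a line: [I] embeds [W], [e] spans the line, [t] reads the
    coordinate along it. Keeping these abstract avoids reassociating iterated sums. *)
Lemma drop_coord_inf (R : realType) N (Z W : normedModType R)
    (I : {linear W -> Z}) (t : {linear Z -> R^o}) (e : Z) (d : R) :
  (forall w r, `|I w + r *: e| = Num.max `|w| `|r|) ->
  (forall w r, t (I w + r *: e) = r) -> (forall z, `|t z| <= `|z|) ->
  Vector.axiom N W -> 1 <= d <= 3 ->
  bilip Z 'rV[R]_N.+1 d -> bilip W 'rV[R]_N d.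
Proof.
move=> nE tE tle vW /andP[d1 d3] [f /linear_inverse[S [fK SK]] fd].
pose s i := f e ord0 i; pose v i := t (S (delta_mx 0 i)).
have tS z : t z = \sum_i f z ord0 i * v i.
  by rewrite -{1}(fK z); exact: (rV_basisE (t \o S)).
have te1 : t e = 1 by rewrite -[RHS](tE 0) linear0 add0r scale1r.
have v1 : \sum_i `|v i| <= 1.
  (* On the sign vector of v the functional t o S takes the value sum |v_i|; [S] and [t] do not
     increase norms. *)
  pose b : 'rV[R]_N.+1 := \row_i Num.sg (v i).
  have <- : t (S b) = \sum_i `|v i|.
    by rewrite tS; apply: eq_bigr => i _; rewrite SK mxE normrEsg.
  apply: le_trans (ler_norm _) _; apply: le_trans (tle _) _.
  have /andP[+ _] := fd (S b); rewrite SK => /le_trans; apply.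
  apply: rV_norm_leP => // i; rewrite mxE normr_sg; by case: (_ == _) => /=.
have [|j [c [c1 c2 c3]]] := @exists_pivot _ _ s v d _ v1 d3.
  by rewrite -te1 tS; apply: eq_bigr => i _; rewrite mulrC.
pose phi w i := f (I w) ord0 i.
have fE w r i : f (I w + r *: e) ord0 i = phi w i + r * s i.
  by rewrite linearD linearZ !mxE.
(* Taking r = |w| and r = -|w| leaves the max norm of (w, r) equal to |w|; the two upper bounds
   combine by [ler_add_norm]. *)
have phile w i : `|phi w i| <= (d - `|s i|) * `|w|.
  have h r : `|r| <= `|w| -> `|phi w i + r * s i| <= d * `|w|.
    move=> rw; rewrite -fE; apply: le_trans (ler_norm_rV _ _) _.
    have /andP[_ /le_trans -> //] := fd (I w + r *: e).
    by rewrite nE max_l.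
  have := h `|w|; rewrite normr_id lexx => /(_ isT) h1.
  have := h (- `|w|); rewrite normrN normr_id lexx mulNr => /(_ isT) h2.
  have := ler_add_norm h1 h2; rewrite normrM normr_id; lra.
pose g w : 'rV[R]_N :=
  \row_k (phi w (lift j k) - c * s (lift j k) * phi w j).
have gE w k : g w ord0 k = phi w (lift j k) - c * s (lift j k) * phi w j.
  by rewrite mxE.
apply: (@bilip_findim _ N _ _ g) => //.
- by exists id => //; exists id.
- by move=> a u w; apply/rowP => k; rewrite !mxE /phi linearP /= linearP /= !mxE; ring.
move=> w; apply/andP; split; last first.
  have d0 : 0 <= d * `|w| by rewrite mulr_ge0 // (le_trans _ d1).
  apply: rV_norm_leP => // k; rewrite gE.
  apply: le_trans (ler_normB _ _) _; rewrite !normrM.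
  (* The correction term costs at most |s_i| |w|, exactly the slack left by [phile]. *)
  have h1 := phile w (lift j k).
  have h2 : `|c| * `|phi w j| <= `|w|.
    apply: le_trans (ler_wpM2l (normr_ge0 c) (phile w j)) _.
    by rewrite mulrA ler_piMl.
  have h3 := ler_wpM2l (normr_ge0 (s (lift j k))) h2.
  lra.
pose r := - (c * phi w j); pose b := f (I w + r *: e).
have bj : b ord0 j = phi w j * `|c| by rewrite /b fE -c1 /r; ring.
have bk k : b ord0 (lift j k) = g w ord0 k by rewrite /b fE gE /r; ring.
have rE : r = b ord0 j * v j + \sum_k g w ord0 k * v (lift j k).
  rewrite -{1}(tE w r) tS (bigD1_ord j) //=; congr (_ + _).
  by apply: eq_bigr => k _; rewrite -/b bk.
have vj : \sum_k `|v (lift j k)| <= 1 - `|v j|.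
  by move: v1; rewrite (bigD1_ord j) //=; lra.
(* Solving [rE] for the phi_j terms gives the factor |c| (1 + |v_j|), while the remaining sum is at
   most |g w| (1 - |v_j|). *)
have bjle : `|b ord0 j| <= `|g w|.
  rewrite -(@ler_pM2r _ (1 + `|v j|)) ?ltr_pwDl //.
  have -> : `|b ord0 j| * (1 + `|v j|) = `|\sum_k g w ord0 k * v (lift j k)|.
    have -> : \sum_k g w ord0 k * v (lift j k) = - phi w j * (c + `|c| * v j).
      by move: rE; rewrite bj /r => rE; lra.
    by rewrite bj !normrM normrN c3 normr_id mulrA.
  apply: le_trans (ler_norm_sum _ _ _) _.
  apply: (@le_trans _ _ (`|g w| * (1 - `|v j|))); last first.
    by rewrite ler_wpM2l // lerD2l; have := normr_ge0 (v j); lra.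
  apply: le_trans (ler_wpM2l (normr_ge0 _) vj); rewrite mulr_sumr ler_sum // => k _.
  by rewrite normrM ler_wpM2r // ler_norm_rV.
have wle : `|w| <= `|I w + r *: e| by rewrite nE le_max lexx.
apply: le_trans wle _; have /andP[/le_trans + _] := fd (I w + r *: e); apply.
rewrite -/b; apply: rV_norm_leP => // i.
by case: (unliftP j i) => [k|] ->; [rewrite bk ler_norm_rV|].
Qed.

(** The transposed construction, for a map out of l_1: now [s] holds the coefficients of t o S and
    [v] is the preimage of [e]. The new map sends the k-th basis vector to P S (e_k - c s_k e_j). *)
Lemma drop_coord1 (R : realType) N (Z W : normedModType R)
    (P : {linear Z -> W}) (t : {linear Z -> R^o}) (e : Z) (d : R) :
  (forall z, `|z| = `|P z| + `|t z|) -> P e = 0 -> t e = 1 ->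
  Vector.axiom N W -> 1 <= d <= 3 ->
  bilip (ell1 R N.+1) Z d -> bilip (ell1 R N) W d.
Proof.
move=> nE Pe te vW /andP[d1 d3] [S /linear_inverse[T [SK TK]] Sd].
pose v : 'rV[R]_N.+1 := T e.
pose s i := t (S (delta_mx 0 i)).
have tS (b : ell1 R N.+1) : t (S b) = \sum_i (b : 'rV_ _) ord0 i * s i.
  exact: (rV_basisE (t \o S : {linear 'rV[R]_N.+1 -> R^o})).
have v1 : \sum_i `|v ord0 i| <= 1.
  by have /andP[+ _] := Sd (T e); rewrite TK nE Pe te normr0 normr1 add0r.
have [|j [c [c1 c2 c3]]] := @exists_pivot _ _ s (v ord0) d _ v1 d3.
  by rewrite -tS /v TK.
(* The image of a basis vector has norm at most [d], and this norm splits into its [W] part and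
   |s_i|. *)
have PSle i : `|P (S (delta_mx 0 i))| <= d - `|s i|.
  have /andP[_] := Sd (delta_mx 0 i); rewrite nE -/(s i) ell1_normE.
  rewrite (bigD1 i) //= big1 => [|k ki]; last first.
    by rewrite mxE (negbTE ki) andbF normr0.
  by rewrite mxE !eqxx normr1; lra.
pose sg (a : 'rV[R]_N) := \sum_k a ord0 k * s (lift j k).
pose beta (a : 'rV[R]_N) : 'rV[R]_N.+1 :=
  \row_i oapp (a ord0) (- c * sg a) (unlift j i).
have bj a : beta a ord0 j = - c * sg a by rewrite mxE unlift_none.
have bk a k : beta a ord0 (lift j k) = a ord0 k by rewrite mxE liftK.
pose g (a : ell1 R N) := P (S (beta a)).
apply: (@bilip_findim _ N _ _ g) => //.
- by exists id => //; exists id.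
- move=> x a b; rewrite /g; have -> : beta (x *: a + b) = x *: beta a + beta b.
    apply/rowP => i; rewrite !mxE; case: (unliftP j i) => [k|] _ /=; rewrite ?mxE //.
    rewrite mulrCA -mulrDr; congr (_ * _); rewrite mulr_sumr -big_split.
    by apply: eq_bigr => k _; rewrite !mxE /= mulrDl mulrA.
  by rewrite !linearP.
move=> a; rewrite ell1_normE.
set A := \sum_k _; set B := \sum_k `|a ord0 k| * `|s (lift j k)|.
have sB : `|sg a| <= B.
  by apply: le_trans (ler_norm_sum _ _ _) _; apply: ler_sum => k _; rewrite normrM.
apply/andP; split; last first.
  have -> : g a = \sum_i beta a ord0 i *: P (S (delta_mx 0 i)).
    by exact: (rV_basisE (P \o S : {linear 'rV[R]_N.+1 -> W})).
  rewrite (bigD1_ord j) //= bj; apply: le_trans (ler_normD _ _) _.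
  (* The inserted j-th entry costs at most |sg a| <= B, which the other columns have to spare. *)
  have h1 : `|- c * sg a *: P (S (delta_mx 0 j))| <= `|sg a|.
    rewrite normrZ normrM normrN mulrAC ler_piMl //.
    by apply: le_trans c2; rewrite ler_wpM2l.
  have h2 :
    `|\sum_k beta a ord0 (lift j k) *: P (S (delta_mx 0 (lift j k)))| <= d * A - B.
    apply: le_trans (ler_norm_sum _ _ _) _.
    rewrite mulr_sumr -sumrB ler_sum // => k _; rewrite bk normrZ.
    by apply: le_trans (ler_wpM2l (normr_ge0 _) (PSle _)) _; rewrite mulrBr mulrC.
  lra.
(* Subtracting [r *: v] removes the [e] component of the image, so the norm in [Z] becomes the norm
   of [g a] in [W]. *)
pose r := t (S (beta a)).
have bvE i : (beta a - r *: v) ord0 i = beta a ord0 i - r * v ord0 i.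
  by rewrite !mxE.
have rE : r = sg a * `|c|.
  rewrite /r tS (bigD1_ord j) //= bj -c1.
  under eq_bigr do rewrite bk.
  rewrite -/(sg a); ring.
have gn : `|g a| = `|S (beta a - r *: v)|.
  have -> : S (beta a - r *: v) = S (beta a) - r *: e.
    by rewrite linearB linearZ /= /v TK.
  have -> : `|S (beta a) - r *: e| =
      `|P (S (beta a) - r *: e)| + `|t (S (beta a) - r *: e)|.
    exact: nE.
  have -> : P (S (beta a) - r *: e) = g a.
    by rewrite linearB linearZ /= Pe scaler0 subr0.
  have -> : t (S (beta a) - r *: e) = 0.
    by rewrite linearB linearZ /= te /GRing.scale /= mulr1 subrr.
  by rewrite normr0 addr0.
have /andP[+ _] := Sd (beta a - r *: v); rewrite gn; apply: le_trans.
(* The j-th entry contributes |r| (1 + |v_j|), while the other entries lose at most |r| (1 - |v_j|)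
   from [A]; the total is at least [A]. *)
rewrite ell1_normE (bigD1_ord j) //=.
have -> : `|(beta a - r *: v) ord0 j| = `|r| * (1 + `|v ord0 j|).
  rewrite bvE.
  have -> : beta a ord0 j - r * v ord0 j = - sg a * (c + `|c| * v ord0 j).
    by rewrite bj rE; ring.
  by rewrite normrM normrN c3 rE normrM normr_id mulrA.
have h k : `|a ord0 k| - `|r| * `|v ord0 (lift j k)|
    <= `|(beta a - r *: v) ord0 (lift j k)|.
  rewrite bvE bk -normrM.
  set x := r * v _ _; rewrite lerBlDr.
  by have := ler_normD (a ord0 k - x) x; rewrite subrK.
have h2 : A - `|r| * \sum_k `|v ord0 (lift j k)|
    <= \sum_k `|(beta a - r *: v) ord0 (lift j k)|.
  by rewrite mulr_sumr -sumrB ler_sum.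
have vj : \sum_k `|v ord0 (lift j k)| <= 1 - `|v ord0 j|.
  by move: v1; rewrite (bigD1_ord j) //=; lra.
have h3 := ler_wpM2l (normr_ge0 r) vj.
have := mulr_ge0 (normr_ge0 r) (normr_ge0 (v ord0 j)).
lra.
Qed.

(** * Direct sums with l_1^m and l_infinity^m *)

Lemma vector_axiom_rV (R : nzRingType) n : Vector.axiom n 'rV[R]_n.
Proof. by exists id => //; exists id. Qed.

Lemma vector_axiom_prod (R : nzRingType) n m (X : lmodType R) :
  Vector.axiom n X -> Vector.axiom (n + m) (X * 'rV[R]_m)%type.
Proof.
case=> f lf bf; exists (fun p : X * 'rV[R]_m => row_mx (f p.1) p.2).
  by move=> a u v /=; rewrite lf scale_row_mx add_row_mx.
case: bf => g fK gK; exists (fun y => (g (lsubmx y), rsubmx y)) => [[x y]|y] /=.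
  by rewrite row_mxKl row_mxKr fK.
by rewrite gK hsubmxK.
Qed.

Lemma norm_row_mx (R : realType) n m (a : 'rV[R]_n) (b : 'rV[R]_m) :
  `|row_mx a b| = Num.max `|a| `|b|.
Proof.
apply/le_anti/andP; split.
  apply: rV_norm_leP => [|i]; first by rewrite le_max normr_ge0.
  by case: (split_ordP i) => k ->; rewrite ?row_mxEl ?row_mxEr le_max ler_norm_rV ?orbT.
rewrite ge_max; apply/andP; split; apply: rV_norm_leP => // k.
  by rewrite -(row_mxEl _ b) ler_norm_rV.
by rewrite -(row_mxEr a) ler_norm_rV.
Qed.

Lemma norm_row_mx1 (R : realType) n m (a : ell1 R n) (b : ell1 R m) :
  `|row_mx a b : ell1 R (n + m)| = `|a| + `|b|.
Proof.
rewrite !ell1_normE big_split_ord /=.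
by congr (_ + _); apply: eq_bigr => i _; rewrite ?row_mxEl ?row_mxEr.
Qed.

Lemma norm_scalar1 (R : realType) (r : R) : `|r%:M : 'rV[R]_1| = `|r|.
Proof.
by rewrite ellinf_normE big_ord_recl big_ord0 mxE eqxx mulr1n max_l.
Qed.

(** Extend by the identity on the second summand, which meets the upper bound since [d] is at least
    1. *)
Lemma bilip_sum_inf (R : realType) n m (X : normedModType R) d :
  Vector.axiom n X -> 1 <= d -> bilip X 'rV[R]_n d ->
  bilip (suminf X 'rV[R]_m) 'rV[R]_(n + m) d.
Proof.
move=> vX d1 [T _ Td].
apply: (@bilip_findim _ (n + m) _ _ (fun p : X * 'rV[R]_m => row_mx (T p.1) p.2)).
- exact: vector_axiom_prod.
- exact: vector_axiom_rV.
- by move=> a u v /=; rewrite linearP scale_row_mx add_row_mx.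
move=> [x y]; rewrite suminf_normE norm_row_mx /=; have /andP[h1 h2] := Td x.
rewrite maxr_pMr ?(le_trans _ d1) //; apply/andP; split; apply: le_max2 => //.
by rewrite ler_peMl.
Qed.

Lemma bilip_unsum_inf (R : realType) n m (X : normedModType R) d :
  Vector.axiom n X -> 1 <= d <= 3 ->
  bilip (suminf X 'rV[R]_m) 'rV[R]_(n + m) d -> bilip X 'rV[R]_n d.
Proof.
move=> vX d13; elim: m => [|m IHm].
  rewrite addn0 => -[T _ Td].
  apply: (@bilip_findim _ n _ _ (fun x => T (x, 0))) => //.
  - exact: vector_axiom_rV.
  - by move=> a u v; rewrite -linearP; congr (T (_, _)); rewrite /= scaler0 addr0.
  by move=> x; have := Td (x, 0); rewrite suminf_normE /= normr0 max_l.
rewrite addnS => h; apply: IHm; move: h.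
(* Reading [m.+1] as [1 + m] makes the removed coordinate the left block of a [row_mx]. *)
have lI : linear (fun w : X * 'rV[R]_m => (w.1, row_mx 0 w.2) : X * 'rV[R]_(1 + m)).
  move=> a [u u'] [w w']; rewrite -[RHS]/(_, _) /=.
  by rewrite scale_row_mx add_row_mx scaler0 addr0.
have lt : linear (fun z : X * 'rV[R]_(1 + m) => z.2 ord0 (lshift m ord0) : R^o).
  by move=> a u w; rewrite /= !mxE.
pose e : X * 'rV[R]_(1 + m) := (0, row_mx 1%:M 0).
have E w r : linear_of lI w + r *: e = (w.1, row_mx r%:M w.2).
  rewrite /linear_of /e -[LHS]/(_, _) /= scaler0 addr0 scale_row_mx add_row_mx.
  by rewrite scaler0 addr0 add0r scale_scalar_mx mulr1.
apply: (@drop_coord_inf _ _ _ _ (linear_of lI) (linear_of lt) e) => //.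
- move=> w r; rewrite E suminf_normE /= norm_row_mx norm_scalar1.
  by rewrite suminf_normE maxAC maxA; congr Num.max; rewrite maxC.
- move=> w r; rewrite E.
  transitivity (row_mx r%:M w.2 ord0 (lshift m ord0)) => //.
  by rewrite row_mxEl mxE eqxx mulr1n.
- move=> z; rewrite suminf_normE /linear_of le_max; apply/orP; right.
  exact: ler_norm_rV.
- exact: vector_axiom_prod.
Qed.

Lemma bilip_sum1 (R : realType) n m (X : normedModType R) d :
  Vector.axiom n X -> 1 <= d -> bilip X (ell1 R n) d ->
  bilip (sum1 X (ell1 R m)) (ell1 R (n + m)) d.
Proof.
move=> vX d1 [T _ Td].
apply: (@bilip_findim _ (n + m) (sum1 X (ell1 R m)) (ell1 R (n + m))
  (fun p => row_mx (T p.1) p.2)).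
- exact: vector_axiom_prod.
- exact: vector_axiom_rV.
- by move=> a u v /=; rewrite linearP scale_row_mx add_row_mx.
move=> [x y]; rewrite sum1_normE norm_row_mx1 /=; have /andP[h1 h2] := Td x.
by rewrite mulrDr; apply/andP; split; apply: lerD => //; rewrite ler_peMl.
Qed.

(** Induction on [m], phrased for maps out of l_1 because [drop_coord1] alters the domain side. *)
Lemma bilip_unsum1 (R : realType) n m (X : normedModType R) d :
  Vector.axiom n X -> 1 <= d <= 3 ->
  bilip (ell1 R (n + m)) (sum1 X (ell1 R m)) d -> bilip (ell1 R n) X d.
Proof.
move=> vX d13; elim: m => [|m IHm].
  rewrite addn0 => -[T _ Td].
  apply: (@bilip_findim _ n _ _ (fun x => (T x).1)) => //.
  - exact: vector_axiom_rV.
  - by move=> a u v; rewrite linearP.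
  move=> x; have := Td x; rewrite sum1_normE.
  by rewrite (ell1_normE (T x).2) big_ord0 addr0.
rewrite addnS => h; apply: IHm; move: h.
have lP : linear (fun z : sum1 X (ell1 R (1 + m)) =>
    (z.1, rsubmx (z.2 : 'rV[R]_(1 + m))) : sum1 X (ell1 R m)).
  move=> a [u u'] [w w']; rewrite -[RHS]/(_, _) /=.
  by rewrite linearP.
have lt : linear (fun z : sum1 X (ell1 R (1 + m)) =>
    (z.2 : 'rV[R]_(1 + m)) ord0 (lshift m ord0) : R^o).
  by move=> a u w; rewrite /= !mxE.
pose e : sum1 X (ell1 R (1 + m)) := (0, row_mx 1%:M 0).
apply: (@drop_coord1 _ _ _ _ (linear_of lP) (linear_of lt) e) => //.
- case=> x y; rewrite /linear_of !sum1_normE /= -{1}(hsubmxK y) norm_row_mx1.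
  rewrite (ell1_normE (lsubmx y)) big_ord1 mxE -addrA; congr (_ + _).
  exact: addrC.
- transitivity ((0, rsubmx (row_mx (1%:M : 'M[R]_1) (0 : 'rV_m)))
    : sum1 X (ell1 R m)) => //.
  by rewrite row_mxKr.
- transitivity (row_mx (1%:M : 'M[R]_1) (0 : 'rV_m) ord0 (lshift m ord0)) => //.
  by rewrite row_mxEl mxE eqxx.
- exact: vector_axiom_prod.
Qed.

Theorem theorem1p2 (R : realType) (n m : nat) (hn : (1 <= n)%N) (hm : (1 <= m)%N) :
  (forall X : normedModType R, Vector.axiom n X ->
     bm_dist X (ell1 R n) <= 3 ->
     bm_dist (sum1 X (ell1 R m)) (ell1 R (n + m)) = bm_dist X (ell1 R n)) /\
  (forall X : normedModType R, Vector.axiom n X ->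
     bm_dist X (ellinf R n) <= 3 ->
     bm_dist (suminf X (ellinf R m)) (ellinf R (n + m)) = bm_dist X (ellinf R n)).
Proof.
have nm0 : (0 < n + m)%N by rewrite ltn_addr.
split=> X vX; apply: (bm_dist_eq hn nm0 vX).
- exact: vector_axiom_rV.
- exact: vector_axiom_prod.
- exact: vector_axiom_rV.
- by move=> d d1; exact: bilip_sum1.
(* Inverting the map before and after dropping the coordinates keeps [d] unchanged. *)
- move=> d d13; have d0 : 0 < d by case/andP: d13 => /(lt_le_trans ltr01).
  by move=> /(bilip_sym d0) /(bilip_unsum1 vX d13) /(bilip_sym d0).
- exact: vector_axiom_rV.
- exact: vector_axiom_prod.
- exact: vector_axiom_rV.
- by move=> d d1; exact: bilip_sum_inf.
- by move=> d; exact: bilip_unsum_inf.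
Qed.
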